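(* Let $n\ge1$ and let $P\in\mathfrak{S}_n$. Let $\alpha_1,\ldots,\alpha_{n-1}\in\mathbb{C}$ be the roots of $P'$, listed with multiplicity. The moment map $\mu:\mathfrak{S}_n\to\mathbb{R}_+\times\mathbb{C}^{n-1}$ is degenerate at $P$ if and only if there exist indices $i,j\in\{1,\ldots,n-1\}$ (the case $i=j$ being permitted) such that $\alpha_i\bar\alpha_j=1$.
   Context: For an integer $n\ge1$, $\mathfrak{S}_n$ denotes the set of polynomials $P(z)=a_1z+a_2z^2+\cdots+a_nz^n$ with complex coefficients, of degree $n$ (so $a_n\neq0$), normalized by $P(0)=0$ and $P'(0)=a_1>0$ (in particular $a_1$ is real). It is identified with the set of coefficient vectors $(a_1,\ldots,a_n)$, an open subset of $\mathbb{R}\times\mathbb{C}^{n-1}$, of real dimension $2n-1$. Complex moments: for $k\ge 0$, $$\mu_k(P)=\frac{i}{2\pi}\iint_{\mathbb{D}}P^k(z)\,|P'(z)|^2\,dz\wedge d\bar z ,$$ where $\mathbb{D}$ is the open unit disk; equivalently $\mu_k(P)=\frac1\pi\iint_{\mathbb D}P^k|P'|^2\,dx\,dy$ with $z=x+iy$. The moment map is $\mu: P\mapsto(\mu_0(P),\ldots,\mu_{n-1}(P))$, from $\mathfrak{S}_n$ to $\mathbb{R}_+\times\mathbb{C}^{n-1}$ (one has $\mu_0(P)>0$), both regarded as real manifolds of dimension $2n-1$. The moment map is said to be degenerate at $P$ if $P$ is a critical point, i.e. its real (Fréchet) differential $d\mu$ at $P$ is singular (not invertible); equivalently, the Jacobian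 determinant $\frac{\partial(\bar\mu_{n-1},\ldots,\bar\mu_1,\mu_0,\mu_1,\ldots,\mu_{n-1})}{\partial(\bar a_n,\ldots,\bar a_2,a_1,a_2,\ldots,a_n)}$ (with Wirtinger derivatives in $a_j,\bar a_j$ for $j\ge2$ and $a_1$ real) vanishes at $P$. *)

(* Defs.v *)
From mathcomp Require Export all_boot all_order all_algebra.
From mathcomp Require Export all_classical all_reals all_analysis.
From mathcomp Require Export complex.

Set Implicit Arguments.
Unset Strict Implicit.
Unset Printing Implicit Defensive.

Import Order.TTheory GRing.Theory Num.Theory.
Import numFieldNormedType.Exports.

Local Open Scope classical_set_scope.
Local Open Scope ring_scope.

(* In R[i], [0 < z] holds iff z is real and its real part is positive. *)
Definition normalized_poly (R : realType) (n : nat) (P : {poly R[i]}) : Prop :=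
  [/\ size P = n.+1, P`_0 = 0 & 0 < P`_1].

Definition unit_disk (R : realType) : set (measurableTypeR R * measurableTypeR R) :=
  [set p | p.1 ^+ 2 + p.2 ^+ 2 < 1].

(* Lebesgue area integral of a complex-valued function of z = x + i y. *)
Definition area_integral (R : realType)
    (D : set (measurableTypeR R * measurableTypeR R)) (f : R[i] -> R[i]) : R[i] :=
  let area := (@lebesgue_measure R \x @lebesgue_measure R)%E in
  Complex (\int[area]_(p in D) complex.Re (f (Complex p.1 p.2)))
          (\int[area]_(p in D) complex.Im (f (Complex p.1 p.2))).

(* Since i dz /\ dzbar = 2 dx dy, the factor i/(2 pi) becomes 1/pi. *)
Definition moment (R : realType) (k : nat) (P : {poly R[i]}) : R[i] :=
  (real_complex R pi)^-1 *
  area_integral (@unit_disk R) (fun z => P.[z] ^+ k * `|P^`().[z]| ^+ 2).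

(* Real coordinates on R x C^(n-1): the sequence u_0, ..., u_(n-1), with u_0
   real, is encoded as (u_0, Re u_1, ..., Re u_(n-1), Im u_1, ..., Im u_(n-1)),
   a vector of length 2n-1 when n >= 1. *)
Definition real_coords (R : realType) (n : nat) (u : nat -> R[i]) :
    'rV[R]_(1 + (n.-1 + n.-1)) :=
  row_mx (complex.Re (u 0%N))%:M
    (row_mx (\row_j complex.Re (u j.+1)) (\row_j complex.Im (u j.+1))).

(* (a_1, ..., a_n) *)
Definition coef_vector (R : realType) (n : nat) (P : {poly R[i]}) :=
  real_coords n (fun j => P`_j.+1).

(* a_1 z + a_2 z^2 + ... + a_n z^n *)
Definition poly_of_coef_vector (R : realType) (n : nat)
    (a : 'rV[R]_(1 + (n.-1 + n.-1))) : {poly R[i]} :=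
  real_complex R (lsubmx a 0 0) *: 'X +
  \sum_(j < n.-1)
    Complex (lsubmx (rsubmx a) 0 j) (rsubmx (rsubmx a) 0 j) *: 'X^(j.+2).

(* The moment map in real coordinates. It is given by the same formula on all
   of R^(2n-1); this does not affect the differential at normalized
   polynomials, whose coefficient vectors form an open set. *)
Definition moment_map (R : realType) (n : nat)
    (a : 'rV[R]_(1 + (n.-1 + n.-1))) : 'rV[R]_(1 + (n.-1 + n.-1)) :=
  real_coords n (fun k => moment k (poly_of_coef_vector a)).

Definition degenerate_at (R : realType) (n : nat) (P : {poly R[i]}) : Prop :=
  ~ bijective ('d (@moment_map R n) (coef_vector n P)).

Lemma coef_vectorK (R : realType) (n : nat) (P : {poly R[i]}) :
  (1 <= n)%N -> normalized_poly n P ->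
  poly_of_coef_vector (coef_vector n P) = P.
Proof.
move=> n_gt0 [sP P0 P1].
rewrite /poly_of_coef_vector /coef_vector /real_coords !row_mxKl !row_mxKr.
rewrite row_mxKl -[RHS]coefK poly_def sP -(prednK n_gt0).
rewrite !big_ord_recl /= P0 scale0r add0r expr1 !mxE eqxx mulr1n.
congr (_ *: _ + _).
  by move: P1; rewrite ltcE /= => /andP[/eqP]; case: (P`_1) => x y /= ->.
by apply: eq_bigr => j _; rewrite !mxE; case: (P`_j.+2).
Qed.

(* Main.v *)
Require Import Defs.
From mathcomp Require Import ring lra measurable_realfun.
Import Order.TTheory GRing.Theory Num.Theory.
Import numFieldNormedType.Exports.
Local Open Scope classical_set_scope.
Local Open Scope ring_scope.

Set Implicit Arguments.
Unset Strict Implicit.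
Unset Printing Implicit Defensive.

(** Stokes' formula for [(1 - |z|^2) z^a zbar^b], which vanishes on the unit
    circle, shows that the monomials [z^a zbar^b] with [a != b] have integral 0
    over the disk, and that the integral of [|z|^(2a)] is [area / (a + 1)]. Hence
    the moments are polynomials in the real and imaginary parts of the
    coefficients of [P]; the value of the area does not matter.

    Write [q = P'], and [q#] for the polynomial [z^(n-1) * conj (q (1 / conj z))].
    In a direction [H = z g] the differential of the [k]-th moment is, up to a
    nonzero constant, the coefficient of [z^(n-1)] in [P^k w], where
    [w = g q# + q g#]. Since [P^k] has valuation [k] and [w] is self-reciprocal,
    [H] is in the kernel if and only if [w = 0].

    If [q] and [q#] are coprime, then [w = 0] forces [g = c q] with [c] imaginary,
    and [c = 0] because [g 0] is real. Otherwise [q] has roots [a] and [b] with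
    [a * conj b = 1], and [g] is [q] times a rational function which is imaginary
    on the circle and has poles only at [a] and [b]. *)

(** * Integrals over the unit disk *)

Section Disk.
Variable R : realType.
Local Notation C := R[i].
Local Notation "x ^*" := (conjc x) : ring_scope.
Local Notation mu := (@lebesgue_measure R).
Local Notation area := (mu \x mu)%E.
Local Notation T := (measurableTypeR R * measurableTypeR R)%type.
Local Notation D := (@unit_disk R).

Lemma measurable_unit_disk : measurable D.
Proof.
have -> : D = (fun p : T => p.1 ^+ 2 + p.2 ^+ 2) @^-1` `]-oo, 1[.
  by apply/seteqP; split=> p /=; rewrite in_itv.
rewrite -[X in measurable X]setTI.
have mD : measurable_fun setT (fun p : T => p.1 ^+ 2 + p.2 ^+ 2).
  apply: measurable_funD; apply: measurable_funX.
    exact: measurable_fst.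
  exact: measurable_snd.
exact: mD.
Qed.

Lemma area_rectangle (a b c d : R) :
  area (`[a, b]%classic `*` `[c, d]%classic) = (mu `[a, b]%classic * mu `[c, d]%classic)%E.
Proof. by rewrite product_measure1E. Qed.

Lemma area_unit_disk_lty : (area D < +oo)%E.
Proof.
apply: (@le_lt_trans _ _ (area (`[-1, 1]%classic `*` `[-1, 1]%classic))).
  apply: le_measure; rewrite ?inE; [exact: measurable_unit_disk|exact: measurableX|].
  move=> [x y]; rewrite /unit_disk/= !in_itv /= => xy.
  by split; apply/andP; split; nra.
by rewrite area_rectangle !lebesgue_measure_itv /= lte_fin; case: ifP => _; rewrite ?mule0 -?EFinM ltry.
Qed.

Lemma area_unit_disk_gt0 : (0 < area D)%E.
Proof.
apply: (@lt_le_trans _ _ (area (`[0, 1/2]%classic `*` `[0, 1/2]%classic))).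
  rewrite area_rectangle !lebesgue_measure_itv /= lte_fin.
  have -> : (0 < 1/2 :> R) by lra.
  by rewrite -EFinD -EFinM lte_fin; nra.
apply: le_measure; rewrite ?inE; [exact: measurableX|exact: measurable_unit_disk|].
by move=> [x y]; rewrite /unit_disk/= !in_itv /= => -[/andP[? ?] /andP[? ?]]; nra.
Qed.

(** On the disk, which has finite area, this implies integrability; unlike integrability it is
    stable under products, so it covers polynomials in the coordinates. *)
Definition bounded_on_disk (g : T -> R) :=
  measurable_fun setT g /\ exists M, forall p, D p -> `|g p| <= M.

Lemma bounded_on_disk_cst a : bounded_on_disk (cst a).
Proof. by split => //; exists `|a|. Qed.

Lemma bounded_on_diskD g h :
  bounded_on_disk g -> bounded_on_disk h -> bounded_on_disk (fun p => g p + h p).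
Proof.
move=> [mg [M gM]] [mh [N hN]]; split; first exact: measurable_funD.
by exists (M + N) => p Dp; rewrite (le_trans (ler_normD _ _))// lerD ?gM ?hN.
Qed.

Lemma bounded_on_diskM g h :
  bounded_on_disk g -> bounded_on_disk h -> bounded_on_disk (fun p => g p * h p).
Proof.
move=> [mg [M gM]] [mh [N hN]]; split; first exact: measurable_funM.
by exists (M * N) => p Dp; rewrite normrM ler_pM ?gM ?hN.
Qed.

Lemma bounded_on_diskN g : bounded_on_disk g -> bounded_on_disk (fun p => - g p).
Proof.
move=> /(bounded_on_diskM (bounded_on_disk_cst (-1))).
by under eq_fun do rewrite mulN1r.
Qed.

Lemma bounded_on_disk_fst : bounded_on_disk fst.
Proof.
split; first exact: measurable_fst.
by exists 1 => -[x y]; rewrite /unit_disk /= ler_norml => xy; apply/andP; split; nra.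
Qed.

Lemma bounded_on_disk_snd : bounded_on_disk snd.
Proof.
split; first exact: measurable_snd.
by exists 1 => -[x y]; rewrite /unit_disk /= ler_norml => xy; apply/andP; split; nra.
Qed.

Lemma bounded_on_disk_integrable g : bounded_on_disk g ->
  area.-integrable D (EFin \o g).
Proof.
move=> [mg [M gM]]; apply: measurable_bounded_integrable.
- exact: measurable_unit_disk.
- exact: area_unit_disk_lty.
- exact: measurable_funTS.
- exists M; split; first exact: num_real.
  by move=> x Mx p Dp; apply: le_trans (ltW Mx); exact: gM.
Qed.

(** * Integration along the slices of the disk *)

Lemma integral_deriv_horner (q : {poly R}) (a b : R) : a < b ->
  (\int[mu]_(x in `]a, b[) q^`().[x]%:E = (q.[b] - q.[a])%:E)%E.
Proof.
move=> ab.
have co (p : {poly R}) : continuous (fun x : R => p.[x]).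
  by move=> x; apply: differentiable_continuous; apply/derivable1_diffP; exact: derivable_horner.
(* The fundamental theorem of calculus is applied on the closed interval; the endpoints form a null
   set. *)
rewrite -(@integral_itv_bndoo _ a b _ true false); last first.
  apply/measurable_EFinP; apply: measurable_funTS; exact: continuous_measurable_fun.
rewrite (@continuous_FTC2 _ _ (fun x => q.[x])) //.
- exact: continuous_subspaceT.
- by split=> [x _||]; [exact: derivable_horner|apply: cvg_at_right_filter|apply: cvg_at_left_filter]; exact: co.
- by move=> x _; rewrite derivE.
Qed.

(** A slice of the disk is the open interval between two points of the circle, or empty. *)
Lemma integral_disk_slice_eq0 (A : set R) (h : R -> R) (y : R) :
  (forall x, A x <-> x ^+ 2 + y ^+ 2 < 1) ->
  (y ^+ 2 < 1 -> let s := Num.sqrt (1 - y ^+ 2) in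
    (\int[mu]_(x in `](- s)%R, s[) (h x)%:E = 0)%E) ->
  (\int[mu]_(x in A) (h x)%:E = 0)%E.
Proof.
move=> AE h0; have [y1|y1] := ltP (y ^+ 2) 1.
  rewrite -[RHS](h0 y1); congr integral; apply/seteqP.
  split=> x /=; rewrite in_itv /= -ltr_norml -sqrtr_sqr ltr_sqrt; try lra.
    by move=> /AE; lra.
  by move=> xy; apply/AE; lra.
have A0 : A = set0 by apply/seteqP; split=> x // /AE; nra.
by rewrite A0 integral_set0.
Qed.

Lemma Rintegral_disk_fst_eq0 g : bounded_on_disk g ->
  (forall y : R, y ^+ 2 < 1 -> let s := Num.sqrt (1 - y ^+ 2) in
     (\int[mu]_(x in `](- s)%R, s[) (g (x, y))%:E = 0)%E) ->
  \int[area]_(p in D) g p = 0.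
Proof.
(* Fubini's theorem is applied on the whole plane, to the extension of [g] by 0. *)
move=> bg g0; rewrite /Rintegral integral_mkcond.
have ig : area.-integrable setT ((EFin \o g) \_ D).
  by rewrite -integrable_mkcond//; [exact: bounded_on_disk_integrable|exact: measurable_unit_disk].
rewrite -(integral21_prod_meas1 ig) integral0_eq// => y _; rewrite /fubini_G.
rewrite -[RHS](@integral_disk_slice_eq0 (fun x => D (x, y)) _ _ _ (g0 y))//.
by rewrite [RHS]integral_mkcond; apply: eq_integral => x _; rewrite !patchE.
Qed.

Lemma Rintegral_disk_snd_eq0 g : bounded_on_disk g ->
  (forall x : R, x ^+ 2 < 1 -> let s := Num.sqrt (1 - x ^+ 2) in
     (\int[mu]_(y in `](- s)%R, s[) (g (x, y))%:E = 0)%E) ->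
  \int[area]_(p in D) g p = 0.
Proof.
move=> bg g0; rewrite /Rintegral integral_mkcond.
have ig : area.-integrable setT ((EFin \o g) \_ D).
  by rewrite -integrable_mkcond//; [exact: bounded_on_disk_integrable|exact: measurable_unit_disk].
rewrite -(integral12_prod_meas1 ig) integral0_eq// => x _; rewrite /fubini_F.
rewrite -[RHS](@integral_disk_slice_eq0 (fun y => D (x, y)) _ _ _ (g0 x))//.
  by rewrite [RHS]integral_mkcond; apply: eq_integral => y _; rewrite !patchE.
by move=> y; rewrite /unit_disk /= addrC.
Qed.

(** * Complex integrands and linearity of the area integral *)

Definition cbounded (f : C -> C) :=
  bounded_on_disk (fun p : T => complex.Re (f (Complex p.1 p.2))) /\
  bounded_on_disk (fun p : T => complex.Im (f (Complex p.1 p.2))).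

Lemma cbounded_cst c : cbounded (fun=> c).
Proof. by split; exact: bounded_on_disk_cst. Qed.

Lemma cbounded_id : cbounded id.
Proof. by split; [exact: bounded_on_disk_fst|exact: bounded_on_disk_snd]. Qed.

Lemma cbounded_conjc : cbounded (@conjc R).
Proof.
by split; [exact: bounded_on_disk_fst|exact: bounded_on_diskN bounded_on_disk_snd].
Qed.

Lemma Re_addc (z w : C) : complex.Re (z + w) = complex.Re z + complex.Re w.
Proof. by case: z; case: w. Qed.

Lemma Im_addc (z w : C) : complex.Im (z + w) = complex.Im z + complex.Im w.
Proof. by case: z; case: w. Qed.

Lemma Re_mulc (z w : C) : complex.Re (z * w) =
  complex.Re z * complex.Re w - complex.Im z * complex.Im w.
Proof. by case: z; case: w. Qed.

Lemma Im_mulc (z w : C) : complex.Im (z * w) =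
  complex.Re z * complex.Im w + complex.Im z * complex.Re w.
Proof. by case: z; case: w. Qed.

Lemma cboundedD f g : cbounded f -> cbounded g -> cbounded (fun z => f z + g z).
Proof.
move=> [f1 f2] [g1 g2]; split.
  by under eq_fun do rewrite Re_addc; exact: bounded_on_diskD.
by under eq_fun do rewrite Im_addc; exact: bounded_on_diskD.
Qed.

Lemma cboundedM f g : cbounded f -> cbounded g -> cbounded (fun z => f z * g z).
Proof.
move=> [f1 f2] [g1 g2]; split.
  under eq_fun do rewrite Re_mulc; apply: bounded_on_diskD; first exact: bounded_on_diskM.
  by apply: bounded_on_diskN; exact: bounded_on_diskM.
by under eq_fun do rewrite Im_mulc; apply: bounded_on_diskD; exact: bounded_on_diskM.
Qed.

Lemma cboundedX f n : cbounded f -> cbounded (fun z => f z ^+ n).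
Proof.
move=> bf; elim: n => [|n ih]; first exact: cbounded_cst.
by under eq_fun do rewrite exprS; exact: cboundedM.
Qed.

Definition bimonomial (a b : nat) (z : C) : C := z ^+ a * (z^*) ^+ b.

Lemma cbounded_bimonomial a b : cbounded (bimonomial a b).
Proof.
by apply: cboundedM; apply: cboundedX; [exact: cbounded_id|exact: cbounded_conjc].
Qed.

Lemma area_integralD f g : cbounded f -> cbounded g ->
  area_integral D (fun z => f z + g z) = area_integral D f + area_integral D g.
Proof.
move=> [f1 f2] [g1 g2]; rewrite /area_integral.
under eq_Rintegral do rewrite Re_addc; under [X in Complex _ X]eq_Rintegral do rewrite Im_addc.
by rewrite !RintegralD//; (exact: measurable_unit_disk || exact: bounded_on_disk_integrable).
Qed.

Lemma area_integralZ c f : cbounded f ->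
  area_integral D (fun z => c * f z) = c * area_integral D f.
Proof.
move=> [f1 f2]; have mD := measurable_unit_disk.
have i1 := bounded_on_disk_integrable f1; have i2 := bounded_on_disk_integrable f2.
rewrite /area_integral.
under eq_Rintegral do rewrite Re_mulc; under [X in Complex _ X]eq_Rintegral do rewrite Im_mulc.
rewrite RintegralB// ?RintegralD// ?RintegralZl//; first by case: c.
all: apply: bounded_on_disk_integrable; apply: bounded_on_diskM => //; exact: bounded_on_disk_cst.
Qed.

Lemma area_integral_sum (I : Type) (r : seq I) (f : I -> C -> C) :
  (forall i, cbounded (f i)) ->
  area_integral D (fun z => \sum_(i <- r) f i z) = \sum_(i <- r) area_integral D (f i).
Proof.
move=> bf; suff [] : cbounded (fun z => \sum_(i <- r) f i z) /\
  area_integral D (fun z => \sum_(i <- r) f i z) = \sum_(i <- r) area_integral D (f i) by [].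
elim: r => [|i r [ih1 ih2]].
  under eq_fun do rewrite big_nil; rewrite big_nil; split; first exact: cbounded_cst.
  by rewrite /area_integral /= /Rintegral integral0.
under eq_fun do rewrite big_cons; rewrite big_cons -ih2; split.
  exact: cboundedD.
exact: area_integralD.
Qed.

(** * Stokes' formula for monomials in z and its conjugate *)

(** Taking real parts of coefficients commutes with derivation and with evaluation at real points,
    which reduces complex polynomials on a line to real ones. *)
Lemma Re_horner (p : {poly C}) : exists q : {poly R}, forall x : R,
  q.[x] = complex.Re p.[real_complex R x] /\
  q^`().[x] = complex.Re p^`().[real_complex R x].
Proof.
elim/poly_ind: p => [|p c [q qP]].
  by exists 0 => x; rewrite !deriv0 !horner0.
exists (q * 'X + (complex.Re c)%:P) => x; have [q1 q2] := qP x.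
rewrite !(derivD, derivM, derivX, derivC) !hornerE /= !Re_addc !Re_mulc /= q1 q2; split; ring.
Qed.

Lemma integral_Re_deriv_eq0 (p : {poly C}) (s : R) : 0 < s ->
  p.[real_complex R s] = 0 -> p.[real_complex R (- s)] = 0 ->
  (\int[mu]_(x in `](- s)%R, s[) (complex.Re p^`().[real_complex R x])%:E = 0)%E.
Proof.
move=> s0 p1 p2; have [q qP] := Re_horner p.
under eq_integral do rewrite -(qP _).2.
rewrite integral_deriv_horner; last by lra.
by rewrite !(qP _).1 p1 p2 subrr.
Qed.

Lemma Im_Re (z : C) : complex.Im z = complex.Re (Complex 0 (-1) * z).
Proof. by case: z => x y; rewrite Re_mulc /=; ring. Qed.

Lemma integral_Im_deriv_eq0 (p : {poly C}) (s : R) : 0 < s ->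
  p.[real_complex R s] = 0 -> p.[real_complex R (- s)] = 0 ->
  (\int[mu]_(x in `](- s)%R, s[) (complex.Im p^`().[real_complex R x])%:E = 0)%E.
Proof.
move=> s0 p1 p2; have := @integral_Re_deriv_eq0 (Complex 0 (-1) *: p) s s0.
rewrite !hornerZ p1 p2 mulr0 => /(_ erefl erefl) <-.
by apply: eq_integral => x _; rewrite derivZ hornerZ Im_Re.
Qed.

(** On each horizontal slice the integrand is the derivative of [p y], which vanishes at both
    ends. *)
Lemma area_integral_dx_eq0 (f : C -> C) (p : R -> {poly C}) : cbounded f ->
  (forall x y, f (Complex x y) = (p y)^`().[real_complex R x]) ->
  (forall x y, x ^+ 2 + y ^+ 2 = 1 -> (p y).[real_complex R x] = 0) ->
  area_integral D f = 0.
Proof.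
move=> [f1 f2] fp p0.
have bnd y : y ^+ 2 < 1 -> let s := Num.sqrt (1 - y ^+ 2) in
  [/\ 0 < s, (p y).[real_complex R s] = 0 & (p y).[real_complex R (- s)] = 0].
  move=> y1 s; have s2 : s ^+ 2 = 1 - y ^+ 2 by rewrite sqr_sqrtr //; lra.
  by split; [rewrite sqrtr_gt0; lra|apply: p0; lra|apply: p0; rewrite sqrrN; lra].
rewrite /area_integral !Rintegral_disk_fst_eq0// => y /bnd[s0 ps pNs] /=.
- by under eq_integral do rewrite fp; exact: integral_Im_deriv_eq0.
- by under eq_integral do rewrite fp; exact: integral_Re_deriv_eq0.
Qed.

Lemma area_integral_dy_eq0 (f : C -> C) (p : R -> {poly C}) : cbounded f ->
  (forall x y, f (Complex x y) = (p x)^`().[real_complex R y]) ->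
  (forall x y, x ^+ 2 + y ^+ 2 = 1 -> (p x).[real_complex R y] = 0) ->
  area_integral D f = 0.
Proof.
move=> [f1 f2] fp p0.
have bnd x : x ^+ 2 < 1 -> let s := Num.sqrt (1 - x ^+ 2) in
  [/\ 0 < s, (p x).[real_complex R s] = 0 & (p x).[real_complex R (- s)] = 0].
  move=> x1 s; have s2 : s ^+ 2 = 1 - x ^+ 2 by rewrite sqr_sqrtr //; lra.
  by split; [rewrite sqrtr_gt0; lra|apply: p0; lra|apply: p0; rewrite sqrrN; lra].
rewrite /area_integral !Rintegral_disk_snd_eq0// => x /bnd[s0 ps pNs] /=.
- by under eq_integral do rewrite fp; exact: integral_Im_deriv_eq0.
- by under eq_integral do rewrite fp; exact: integral_Re_deriv_eq0.
Qed.

(* The d/dz and d/dzbar derivatives of [(1 - z * z^*%C) * bimonomial a b z]. *)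
Definition dz_bimonomial (a b : nat) (z : C) : C :=
  a%:R * bimonomial a.-1 b z - a.+1%:R * bimonomial a b.+1 z.

Definition dzbar_bimonomial (a b : nat) (z : C) : C :=
  b%:R * bimonomial a b.-1 z - b.+1%:R * bimonomial a.+1 b z.

Lemma cbounded_dz_bimonomial a b : cbounded (dz_bimonomial a b).
Proof.
rewrite /dz_bimonomial; under eq_fun do rewrite -mulNr.
by apply: cboundedD; apply: cboundedM; by [exact: cbounded_cst|exact: cbounded_bimonomial].
Qed.

Lemma cbounded_dzbar_bimonomial a b : cbounded (dzbar_bimonomial a b).
Proof.
rewrite /dzbar_bimonomial; under eq_fun do rewrite -mulNr.
by apply: cboundedD; apply: cboundedM; by [exact: cbounded_cst|exact: cbounded_bimonomial].
Qed.

(** The restriction of [(1 - |z|^2) z^a zbar^b] to a line. Since conjugation is not polynomial, z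
    and zbar get separate affine parametrizations: [u = v = 1] for horizontal lines, [u = 'i] and
    [v = - 'i] for vertical ones. *)
Definition line_poly (u v c d : C) (a b : nat) : {poly C} :=
  let Z := u *: 'X + c%:P in let W := v *: 'X + d%:P in
  (1 - Z * W) * (Z ^+ a * W ^+ b).

Lemma deriv_line_poly (u v c d t z : C) a b :
  u * t + c = z -> v * t + d = z^* ->
  (line_poly u v c d a b)^`().[t] =
  u * dz_bimonomial a b z + v * dzbar_bimonomial a b z.
Proof.
move=> zE wE; rewrite /line_poly /dz_bimonomial /dzbar_bimonomial /bimonomial.
set Z := u *: 'X + c%:P; set W := v *: 'X + d%:P.
have -> : (1 - Z * W) * (Z ^+ a * W ^+ b) = Z ^+ a * W ^+ b - Z ^+ a.+1 * W ^+ b.+1.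
  by rewrite !exprS; ring.
have Zt : Z.[t] = z by rewrite !hornerE.
have Wt : W.[t] = z^* by rewrite !hornerE.
have dZ : Z^`() = u%:P by rewrite derivD derivZ derivX derivC addr0 alg_polyC.
have dW : W^`() = v%:P by rewrite derivD derivZ derivX derivC addr0 alg_polyC.
have dX n (Q : {poly C}) : (Q ^+ n)^`() = n%:R%:P * (Q^`() * Q ^+ n.-1).
  by rewrite deriv_exp polyC_natr mulr_natl.
clearbody Z W; rewrite derivB !derivM !dX dZ dW !(hornerMn, hornerE, horner_exp) Zt Wt /=.
rewrite -!natr1 !exprS.
move: (z ^+ a) (z ^+ a.-1) (z^* ^+ b) (z^* ^+ b.-1) (a%:R : C) (b%:R : C) (z^*) => A A' B B' a' b' w.
ring.
Qed.

Lemma horner_line_poly_eq0 (u v c d t z : C) a b :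
  u * t + c = z -> v * t + d = z^* -> z * z^* = 1 ->
  (line_poly u v c d a b).[t] = 0.
Proof.
move=> zE wE zw; rewrite /line_poly hornerM.
by rewrite [X in X * _](_ : _ = 0) ?mul0r// !hornerE zE wE zw subrr.
Qed.

(** The integrals of d/dx = d/dz + d/dzbar and of d/dy = i (d/dz - d/dzbar) both vanish, which gives
    [F + G = 0] and [F - G = 0]. *)
Lemma area_integral_dz_bimonomial a b : area_integral D (dz_bimonomial a b) = 0.
Proof.
have circle (x y : R) : x ^+ 2 + y ^+ 2 = 1 -> Complex x y * (Complex x y)^* = 1.
  move=> xy; apply/eqP; rewrite eq_complex /=; apply/andP; split; apply/eqP; lra.
have i2 : 'i%C ^+ 2 = -1 :> C by exact: sqr_i.
set F := area_integral D (dz_bimonomial a b).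
set G := area_integral D (dzbar_bimonomial a b).
have cF := cbounded_dz_bimonomial a b; have cG := cbounded_dzbar_bimonomial a b.
have lin u v : cbounded (fun z => u * dz_bimonomial a b z + v * dzbar_bimonomial a b z) /\
    area_integral D (fun z => u * dz_bimonomial a b z + v * dzbar_bimonomial a b z) = u * F + v * G.
  have cu : cbounded (fun z => u * dz_bimonomial a b z) by apply: cboundedM => //; exact: cbounded_cst.
  have cv : cbounded (fun z => v * dzbar_bimonomial a b z) by apply: cboundedM => //; exact: cbounded_cst.
  by split; [exact: cboundedD|rewrite area_integralD// !area_integralZ].
have dx : F + G = 0.
  have [c1 iFG] := lin 1 1; rewrite -[F]mul1r -[G]mul1r -iFG.
  apply: (area_integral_dx_eq0 c1 (p := fun y => line_poly 1 1 (Complex 0 y) (Complex 0 (- y)) a b)).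
    move=> x y; rewrite (deriv_line_poly (z := Complex x y))// mul1r;
    by apply/eqP; rewrite eq_complex /= ?addr0 ?add0r !eqxx.
  move=> x y /circle; apply: horner_line_poly_eq0; rewrite mul1r;
  by apply/eqP; rewrite eq_complex /= ?addr0 ?add0r !eqxx.
have dy : F - G = 0.
  have [c1 iFG] := lin 'i%C (- 'i%C).
  have : 'i%C * F + - 'i%C * G = 0.
    rewrite -iFG.
    apply: (area_integral_dy_eq0 c1 (p := fun x => line_poly 'i%C (- 'i%C) x%:C%C x%:C%C a b)).
      move=> x y; rewrite (deriv_line_poly (z := Complex x y))//;
      by apply/eqP; rewrite eq_complex /=; apply/andP; split; apply/eqP; ring.
    move=> x y /circle; apply: horner_line_poly_eq0;
    by apply/eqP; rewrite eq_complex /=; apply/andP; split; apply/eqP; ring.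
  move=> h; have : - 'i%C * ('i%C * F + - 'i%C * G) = 0 by rewrite h mulr0.
  by move=> <-; transitivity (- 'i%C ^+ 2 * (F - G)); [rewrite i2 opprK mul1r|ring].
have : F + F = 0 by rewrite -[RHS]addr0 -{1}dx -dy; ring.
by rewrite -mulr2n => /eqP; rewrite mulrn_eq0 /= => /eqP.
Qed.

(** For [a = 0] the left side is 0 whatever the value of [a.-1], so the integral of [zbar^(b+1)]
    vanishes. *)
Lemma area_integral_bimonomial_rec a b :
  a%:R * area_integral D (bimonomial a.-1 b) =
  a.+1%:R * area_integral D (bimonomial a b.+1).
Proof.
apply/eqP; rewrite -subr_eq0 -(area_integral_dz_bimonomial a b) /dz_bimonomial.
under eq_fun do rewrite -mulNr.
have cm c i j : cbounded (fun z => c * bimonomial i j z).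
  by apply: cboundedM; [exact: cbounded_cst|exact: cbounded_bimonomial].
by rewrite area_integralD ?cm// !area_integralZ ?mulNr//; exact: cbounded_bimonomial.
Qed.

Lemma area_integral_conjc f : cbounded f ->
  area_integral D (fun z => (f z)^*) = (area_integral D f)^*.
Proof.
move=> [f1 f2]; rewrite /area_integral /=; congr Complex.
  by apply: eq_Rintegral => p _; case: (f _).
transitivity (\int[area]_(p in D) (-1 * complex.Im (f (Complex p.1 p.2)))).
  by apply: eq_Rintegral => p _; case: (f _) => x y /=; rewrite mulN1r.
by rewrite RintegralZl ?mulN1r//; [exact: measurable_unit_disk|exact: bounded_on_disk_integrable].
Qed.

Lemma area_integral_bimonomial_conj a b :
  area_integral D (bimonomial a b) = (area_integral D (bimonomial b a))^*.
Proof.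
rewrite -area_integral_conjc; last exact: cbounded_bimonomial.
congr area_integral; apply/funext => z.
by rewrite /bimonomial rmorphM !rmorphXn /= conjcK mulrC.
Qed.

(** The recursion moves along the diagonals where [a - b] is constant; there remain the borders
    [a = 0] and, by conjugation, [b = 0]. *)
Lemma area_integral_bimonomial a b : area_integral D (bimonomial a b) =
  (a == b)%:R * (real_complex R (fine (area D)) / a.+1%:R).
Proof.
have n0 k : k.+1%:R != 0 :> C by rewrite pnatr_eq0.
elim: a b => [|a ih] [|b].
- have -> : bimonomial 0 0 = fun=> 1 by apply/funext => z; rewrite /bimonomial mulr1.
  have mD := measurable_unit_disk.
  by rewrite mul1r divr1 /area_integral /= !(@Rintegral_cst _ _ _ area _ mD) mul1r mul0r.
- have := area_integral_bimonomial_rec 0 b.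
  by rewrite mul0r mul1r eq_sym /= => <-; rewrite mul0r.
- rewrite area_integral_bimonomial_conj; have := area_integral_bimonomial_rec 0 a.
  by rewrite mul0r mul1r => <-; rewrite conjc0 mul0r.
- have := area_integral_bimonomial_rec a.+1 b; rewrite [_.-1]/= ih => h.
  apply: (mulfI (n0 a.+1)); rewrite -h eqSS [LHS]mulrCA [RHS]mulrCA.
  by rewrite ![_.+1%:R * _]mulrC !divfK.
Qed.

(** * Moments as pairings of coefficients *)

(** Up to the area, the inner product of the Bergman space of the disk, truncated at [N]. *)
Definition bergman_prod N (f g : {poly C}) : C :=
  \sum_(j < N) f`_j * (g`_j)^* / j.+1%:R.

Lemma area_integral_horner_conj N (f g : {poly C}) : (size g <= N)%N ->
  area_integral D (fun z => f.[z] * (g.[z])^*) =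
  real_complex R (fine (area D)) * bergman_prod N f g.
Proof.
move=> sg; pose M := (size f + N)%N.
have sfM : (size f <= M)%N by exact: leq_addr.
have sgM : (size g <= M)%N by apply: leq_trans sg _; exact: leq_addl.
have cm (c : C) i j : cbounded (fun z => c * bimonomial i j z).
  by apply: cboundedM; [exact: cbounded_cst|exact: cbounded_bimonomial].
under eq_fun => z.
  rewrite (horner_coef_wide _ sfM) (horner_coef_wide _ sgM) rmorph_sum big_distrlr /= pair_bigA /=.
  under eq_bigr => p _.
    rewrite rmorphM rmorphXn /= mulrACA.
    over.
  over.
rewrite (area_integral_sum _ (f := fun (p : 'I_M * 'I_M) z =>
  f`_p.1 * (g`_p.2)^* * bimonomial p.1 p.2 z)) => [|p]; last exact: cm.
transitivity (\sum_(i < M) \sum_(j < M) f`_i * (g`_j)^* * ((i == j)%:R *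
     (real_complex R (fine (area D)) / i.+1%:R))).
  under eq_bigr => p _.
    rewrite area_integralZ; last exact: cbounded_bimonomial.
    rewrite area_integral_bimonomial; over.
  by rewrite [RHS]pair_bigA.
(* Although [f] may be longer, indices from [N] on contribute 0 because [g] has no coefficient
   there. *)
rewrite /bergman_prod (big_ord_widen M (fun j => f`_j * (g`_j)^* / j.+1%:R)) ?leq_addl//.
rewrite mulr_sumr [RHS]big_mkcond /=; apply: eq_bigr => i _.
rewrite (bigD1 i)//= big1 => [|j /negPf ji]; last by rewrite eq_sym ji mul0r mulr0.
rewrite eqxx mul1r addr0; case: ltnP => [_|Ni]; first by rewrite mulrCA.
by rewrite [g`_i]nth_default ?(leq_trans sg)// conjc0 mulr0 mul0r.
Qed.

Lemma moment_bergman N k (P : {poly C}) : (size P^`() <= N)%N ->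
  moment k P = real_complex R (pi^-1 * fine (area D)) *
    bergman_prod N (P ^+ k * P^`()) P^`().
Proof.
move=> sP; rewrite rmorphM fmorphV -mulrA -(area_integral_horner_conj _ sP) /moment.
congr (_ * area_integral _ _); apply/funext => z.
by rewrite hornerM horner_exp sqr_normc mulrA.
Qed.

Lemma pi_area_neq0 : pi^-1 * fine (area D) != 0 :> R.
Proof.
rewrite mulf_neq0 ?invr_eq0 ?gt_eqF ?pi_gt0// fine_gt0//.
by rewrite area_unit_disk_gt0 area_unit_disk_lty.
Qed.

End Disk.

(** * Conjugate reversal of polynomials *)

Section ConjRev.
Variable R : rcfType.
Local Notation C := R[i].
Local Notation "x ^*" := (conjc x) : ring_scope.
Implicit Types (p q : {poly C}) (m : nat) (z : C).

Lemma conjc_gt0 z : 0 < z -> z^* = z.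
Proof. by case: z => x y; rewrite ltcE /= => /andP[/eqP->]; rewrite oppr0. Qed.

(** This is [q#] for any degree bound [m]; on the unit circle its value is [z ^+ m] times the
    conjugate of that of [p], if [p] has degree at most [m]. *)
Definition conj_rev m p : {poly C} := \poly_(i < m.+1) (p`_(m - i))^*.

Lemma size_conj_rev m p : (size (conj_rev m p) <= m.+1)%N.
Proof. exact: size_poly. Qed.

Lemma horner_conj_rev m p z : (size p <= m.+1)%N -> z != 0 ->
  (conj_rev m p).[z] = z ^+ m * (p.[(z^-1)^*])^*.
Proof.
move=> sp z0; rewrite horner_poly (horner_coef_wide _ sp) rmorph_sum mulr_sumr.
rewrite (reindex_inj rev_ord_inj) /=; apply: eq_bigr => -[i im] _ /=.
rewrite subSS subKn -1?ltnS// rmorphM rmorphXn /= conjcK.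
by rewrite mulrCA exprVn -expfB_cond ?(negPf z0)// -ltnS.
Qed.

Lemma conj_revZ m a p : conj_rev m (a *: p) = a^* *: conj_rev m p.
Proof.
apply/polyP=> i; rewrite coefZ !coef_poly; case: ifP => _; last by rewrite mulr0.
by rewrite coefZ rmorphM.
Qed.

(** Identities about [conj_rev] can thus be checked where [horner_conj_rev] applies. The positive
    integers provide enough roots. *)
Lemma poly_eq0_horner p : (forall z, z != 0 -> p.[z] = 0) -> p = 0.
Proof.
move=> p0; apply/eqP/negPn/negP => pN0.
pose s := [seq i.+1%:R : C | i <- iota 0 (size p)].
have : (size s < size p)%N.
  apply: (max_poly_roots pN0).
    by apply/allP=> _ /mapP[i _ ->]; apply/rootP/p0; rewrite pnatr_eq0.
  rewrite map_inj_uniq ?iota_uniq// => i j /eqP.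
  by rewrite eqr_nat eqSS => /eqP.
by rewrite size_map size_iota ltnn.
Qed.

(** A common root [a] is nonzero because q(0) is; [b] is then its reflection in the unit circle. *)
Lemma exists_inverse_conj_roots m q : size q = m.+1 -> q`_0 != 0 ->
  ~~ coprimep q (conj_rev m q) ->
  exists a b, [/\ root q a, root q b & a * b^* = 1].
Proof.
move=> sq q0; rewrite /coprimep => /closed_rootP[a].
rewrite root_gcd => /andP[qa /rootP].
have aN0 : a != 0.
  by apply: contraNneq q0 => a0; move: qa; rewrite a0 rootE horner_coef0.
rewrite horner_conj_rev ?sq// => /eqP.
rewrite mulf_eq0 expf_eq0 (negPf aN0) andbF /= conjc_eq0 => qb.
by exists a, (a^-1)^*; split; rewrite ?rootE// conjcK mulfV.
Qed.

(* On the unit circle [g * conj_rev m q + q * conj_rev m g] is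
   [2 z ^+ m] times the real part of [g * conjc q]. *)
Lemma coprime_conj_rev_eq0 m q (g : {poly C}) : size q = m.+1 -> 0 < q`_0 ->
  coprimep q (conj_rev m q) -> (size g <= m.+1)%N -> (g`_0)^* = g`_0 ->
  g * conj_rev m q + q * conj_rev m g = 0 -> g = 0.
Proof.
move=> sq q0 cop sg g0 eq0.
have qN0 : q != 0 by rewrite -size_poly_eq0 sq.
(* [q] divides g q# = - q g# and is coprime to q#. *)
have /(dvdpP _ _)[h gE] : q %| g.
  rewrite -(Gauss_dvdpl _ cop) (_ : _ * _ = - conj_rev m g * q) ?dvdp_mulIr//.
  by rewrite mulNr mulrC [in RHS]mulrC; apply/eqP; rewrite -addr_eq0 mulrC eq0.
have [c hc] : exists c, h = c%:P.
  have [->|hN0] := eqVneq h 0; first by exists 0.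
  exists h`_0; apply: size1_polyC.
  by move: sg; rewrite gE size_mul// sq addnS /= -(addn1 m) addnC leq_add2l.
(* The equation becomes q q# times [c + conjc c] equals 0. If [c] is imaginary, it is also real, as
   g(0) and q(0) are; otherwise q# = 0, contradicting its top coefficient. *)
move: eq0; rewrite gE hc mul_polyC conj_revZ -scalerAl -scalerAr -scalerDl.
move/eqP; rewrite scaler_eq0 mulf_eq0 (negPf qN0) /=.
case/orP => [/eqP cc|].
  move: g0; rewrite gE hc mul_polyC coefZ rmorphM /=.
  rewrite (conjc_gt0 q0) => /mulIf -/(_ (lt0r_neq0 q0)) c'.
  by move/eqP: cc; rewrite c' -mulr2n mulrn_eq0 /= => /eqP ->; rewrite scale0r.
move/eqP/(congr1 (fun p : {poly C} => p`_m)); rewrite coef_poly ltnSn subnn coef0.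
by move/eqP; rewrite conjc_eq0 (gt_eqF q0).
Qed.

(** The common factor [s] only contributes [s] times its reflection; the remaining condition says
    that [p' / p] is imaginary on the unit circle. *)
Lemma conj_rev_factor m (s p p' : {poly C}) :
  (size (s * p)%R <= m.+1)%N -> (size (s * p')%R <= m.+1)%N ->
  (forall z, z != 0 ->
    p'.[z] * (p.[(z^-1)^*])^* + p.[z] * (p'.[(z^-1)^*])^* = 0) ->
  s * p' * conj_rev m (s * p) + s * p * conj_rev m (s * p') = 0.
Proof.
move=> sp sp' H; apply: poly_eq0_horner => z z0.
rewrite hornerD !hornerM !horner_conj_rev// !hornerM !rmorphM /=.
transitivity (z ^+ m * s.[z] * (s.[(z^-1)^*])^* *
   (p'.[z] * (p.[(z^-1)^*])^* + p.[z] * (p'.[(z^-1)^*])^*)); first by ring.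
by rewrite H ?mulr0.
Qed.

(* The solution is [q] times a rational function that is purely imaginary on the
   unit circle, has poles only at [a] and [b], and takes the value 1 at 0. *)
Lemma exists_conj_rev_solution m q a b : size q = m.+1 -> 0 < q`_0 ->
  root q a -> root q b -> a * b^* = 1 ->
  exists g : {poly C}, [/\ g != 0, (size g <= m.+1)%N, (g`_0)^* = g`_0 &
    g * conj_rev m q + q * conj_rev m g = 0].
Proof.
move=> sq q0 qa qb ab.
have qN0 : q != 0 by rewrite -size_poly_eq0 sq.
have q0r := conjc_gt0 q0.
have aN0 : a != 0 by apply: contra_eq_neq ab => ->; rewrite mul0r eq_sym oner_eq0.
have bE : b^* = a^-1 by apply: (mulfI aN0); rewrite ab mulfV.
have bE' : b = (a^*)^-1 by rewrite -[b]conjcK bE conjc_inv.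
have aN0' : a^* != 0 by rewrite conjc_eq0.
(* It suffices to replace a factor [p] of [q] by some [p'], not longer and with the same value at 0,
   such that [p' / p] is imaginary on the circle. *)
have gen (s p p' : {poly C}) : q = s * p -> (size p' <= size p)%N -> p'`_0 = p`_0 ->
  (forall z, z != 0 ->
    p'.[z] * (p.[(z^-1)^*])^* + p.[z] * (p'.[(z^-1)^*])^* = 0) -> 
  exists g : {poly C}, [/\ g != 0, (size g <= m.+1)%N, (g`_0)^* = g`_0 &
    g * conj_rev m q + q * conj_rev m g = 0].
  move=> qE sp' p0 H.
  have gq : (s * p')`_0 = q`_0 by rewrite qE -!horner_coef0 !hornerM !horner_coef0 p0.
  have sg : (size (s * p')%R <= m.+1)%N.
    have /andP[sN0 pN0] : (s != 0) && (p != 0) by rewrite -negb_or -mulf_eq0 -qE.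
    apply: (leq_trans (size_polyMleq _ _)).
    by rewrite -sq qE size_mul// -!subn1 leq_sub2r// leq_add2l.
  exists (s * p'); split => //.
  - by apply: contraTneq q0 => g0; rewrite -gq g0 coef0 ltxx.
  - by rewrite gq.
  - by rewrite qE; apply: conj_rev_factor => //; rewrite -qE sq.
(* If [a = b], then [a] lies on the circle and the ratio is the Cayley transform (a + z) / (a -
   z). *)
have [eab|neab] := eqVneq a b.
  have [s qE] := factor_theorem _ _ qa.
  have a1 : a^* = a^-1 by rewrite [in LHS]eab bE.
  apply: (gen s ('X - a%:P) (- ('X + a%:P)) qE).
  - by rewrite size_polyN size_XaddC size_XsubC.
  - by rewrite coefN coefD coefB coefX !coefC /= add0r sub0r.
  - move=> z z0; rewrite !hornerE !(rmorphN, rmorphD, rmorphB) /= conjcK a1.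
    by field; rewrite z0 aN0.
have [s1 qE1] := factor_theorem _ _ qa.
have /factor_theorem[s qE2] : root s1 b.
  move: qb; rewrite qE1 rootM root_XsubC => /orP[//|/eqP ba].
  by rewrite ba eqxx in neab.
have fac : 1 - a^* *: 'X = - a^* *: ('X - b%:P).
  by rewrite -!mul_polyC mulrBr -polyCM mulNr bE' mulfV// !polyCN mulNr opprK addrC.
have qE : q = (- (a^*)^-1 *: s) * (('X - a%:P) * (1 - a^* *: 'X)).
  rewrite qE1 qE2 -mulrA -scalerAl scalerAr; congr (_ * _).
  rewrite fac.
  by rewrite -scalerAr scalerA mulrN mulNr opprK mulVf// scale1r mulrC.
(* Put w = z conj(a). On the circle, dividing numerator and denominator by z turns the ratio into (w
   - conj(w)) / |1 - w|^2, which is imaginary. *)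
apply: (gen _ _ (a^* *: 'X^2 - a%:P) qE).
- have : size (('X - a%:P) * (1 - a^* *: 'X))%R = 3%N.
    rewrite fac mulrC.
    by rewrite -scalerAl size_scale ?oppr_eq0// size_mul ?polyXsubC_eq0// !size_XsubC.
  move=> ->; apply: (leq_trans (size_polyD _ _)).
  rewrite geq_max size_polyN size_polyC (leq_trans (size_scale_leq _ _)) ?size_polyXn//.
  by case: (a != 0).
- by rewrite -!horner_coef0 !hornerE /=; ring.
- move=> z z0; rewrite !hornerE !(rmorphN, rmorphD, rmorphB, rmorphM, rmorphXn, rmorph1) /= !conjcK.
  by field; rewrite z0.
Qed.

End ConjRev.

(** * Self-reciprocal polynomials and a triangular system *)

Section Algebra.
Variable R : rcfType.
Local Notation C := R[i].
Local Notation "x ^*" := (conjc x) : ring_scope.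

Lemma coef_mul_conj_rev m (f q : {poly C}) :
  (f * conj_rev m q)`_m = \sum_(j < m.+1) f`_j * (q`_j)^*.
Proof.
rewrite coefM; apply: eq_bigr => -[j jm] _ /=.
by rewrite coef_poly ltnS leq_subr subKn.
Qed.

(** Reversal is an involution, and in degree [m + m] it maps a product to the product of the
    reversals in degree [m]; so it exchanges the two summands. *)
Lemma conj_rev_herm m (g q : {poly C}) : (size g <= m.+1)%N -> (size q <= m.+1)%N ->
  let w := g * conj_rev m q + q * conj_rev m g in conj_rev (m + m) w = w.
Proof.
move=> sg sq w.
have sw : (size w <= (m + m).+1)%N.
  have sM (f h : {poly C}) : (size f <= m.+1)%N -> (size (f * conj_rev m h)%R <= (m + m).+1)%N.
    move=> sf; apply: leq_trans (size_polyMleq _ _) _.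
    by rewrite -subn1 leq_subLR add1n -addnS -addSn leq_add// size_conj_rev.
  by rewrite (leq_trans (size_polyD _ _))// geq_max !sM.
apply/eqP; rewrite -subr_eq0; apply/eqP/poly_eq0_horner => z z0.
have z'0 : (z^-1)^* != 0 by rewrite conjc_eq0 invr_eq0.
rewrite hornerD hornerN horner_conj_rev// /w !hornerD !hornerM !horner_conj_rev//.
rewrite !conjc_inv !invrK !conjcK -!conjc_inv rmorphD !rmorphM !rmorphXn /= !conjcK exprD exprVn.
by field; rewrite expf_neq0.
Qed.

(** Reversal exchanges the coefficients [i] and [m + m - i], so the lower half determines the
    rest. *)
Lemma herm_lower_eq0 m (w : {poly C}) : conj_rev (m + m) w = w ->
  (forall i, (i <= m)%N -> w`_i = 0) -> w = 0.
Proof.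
move=> wE w0; apply/polyP => i; rewrite coef0.
have [im|mi] := leqP i m; first exact: w0.
rewrite -wE coef_poly; case: ifP => // _.
by rewrite w0 ?conjc0// leq_subLR leq_add2r ltnW.
Qed.

(* The pairings with the powers of [p] form a triangular system, since [p ^+ k]
   has valuation [k]. *)
Lemma coef_powers_mul_eq0 (F : idomainType) m (p w : {poly F}) :
  p`_0 = 0 -> p`_1 != 0 ->
  (forall k, (k <= m)%N -> (p ^+ k * w)`_m = 0) ->
  forall i, (i <= m)%N -> w`_i = 0.
Proof.
move=> p0 p1 pw.
have [q pE] : exists q, p = q * 'X.
  have /factor_theorem[q ->] : root p 0 by rewrite rootE horner_coef0 p0.
  by exists q; rewrite subr0.
have q0 : q`_0 != 0 by move: p1; rewrite pE coefMX.
elim/ltn_ind => i ih im.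
(* For k = m - i, the factor X^k of p^k turns coefficient m into coefficient i of q^k w, where by
   induction only q(0)^k w_i is left. *)
have := pw _ (leq_subr i m); rewrite pE exprMn mulrAC coefMXn.
rewrite ltnNge leq_subr /= subKn// coefM big_ord_recl /= subn0 big1 => [|j _].
  rewrite addr0 => /eqP; rewrite mulf_eq0 => /orP[|/eqP//].
  by rewrite -horner_coef0 horner_exp expf_eq0 horner_coef0 (negPf q0) andbF.
rewrite (ih (i - bump 0 j)%N) ?mulr0// /bump /=.
  by rewrite ltn_subLR ?add1n ?ltn_ord// addSn ltnS leq_addl.
by rewrite (leq_trans (leq_subr _ _)).
Qed.

End Algebra.

(** * Coefficient vectors and the differential of the moment map *)

(** Translates degeneracy into a nonzero kernel vector: a square matrix with trivial kernel is
    invertible. *)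
Lemma bijective_linear_rowP (F : fieldType) N (f : {linear 'rV[F]_N -> 'rV[F]_N}) :
  bijective f <-> forall v, f v = 0 -> v = 0.
Proof.
split=> [/bij_inj fI v fv|f0]; first by apply: fI; rewrite fv linear0.
have fr : lin1_mx f \in unitmx.
  rewrite -row_free_unit; apply: inj_row_free => v.
  by rewrite mul_rV_lin1; exact: f0.
exists (fun u => u *m invmx (lin1_mx f)) => v.
  by rewrite -mul_rV_lin1 mulmxK.
by rewrite -mul_rV_lin1 mulmxKV.
Qed.

Section CoefVector.
Variable R : realType.
Local Notation C := R[i].
Local Notation "x ^*" := (conjc x) : ring_scope.

Lemma coef0_poly_of_coef_vector n (a : 'rV[R]_(1 + (n.-1 + n.-1))) :
  (poly_of_coef_vector a)`_0 = 0.
Proof.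
rewrite coefD coefZ coefX mulr0 add0r coef_sum big1// => j _.
by rewrite coefZ coefXn mulr0.
Qed.

Lemma coef1_poly_of_coef_vector n (a : 'rV[R]_(1 + (n.-1 + n.-1))) :
  (poly_of_coef_vector a)`_1 = real_complex R (lsubmx a 0 0).
Proof.
rewrite coefD coefZ coefX mulr1 coef_sum big1 ?addr0// => j _.
by rewrite coefZ coefXn mulr0.
Qed.

Lemma coefSS_poly_of_coef_vector n (a : 'rV[R]_(1 + (n.-1 + n.-1))) (j : 'I_n.-1) :
  (poly_of_coef_vector a)`_j.+2 =
  Complex (lsubmx (rsubmx a) 0 j) (rsubmx (rsubmx a) 0 j).
Proof.
rewrite coefD coefZ coefX mulr0 add0r coef_sum (bigD1 j)//= big1 => [|k kj].
  by rewrite coefZ coefXn eqxx mulr1 addr0.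
by rewrite coefZ coefXn !eqSS [_ == _ :> nat]eq_sym (negPf kj : (k == j :> nat) = false) mulr0.
Qed.

Lemma size_poly_of_coef_vector n (a : 'rV[R]_(1 + (n.-1 + n.-1))) :
  (size (poly_of_coef_vector a) <= n.-1.+2)%N.
Proof.
apply: leq_trans (size_polyD _ _) _; rewrite geq_max; apply/andP; split.
  by rewrite (leq_trans (size_scale_leq _ _))// size_polyX.
apply: leq_trans (size_sum _ _ _) _; apply/bigmax_leqP => j _.
by rewrite (leq_trans (size_scale_leq _ _))// size_polyXn !ltnS.
Qed.

Lemma poly_of_coef_vectorK n (a : 'rV[R]_(1 + (n.-1 + n.-1))) :
  coef_vector n (poly_of_coef_vector a) = a.
Proof.
rewrite -[RHS]hsubmxK -[X in row_mx _ X]hsubmxK; congr row_mx; last congr row_mx.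
- rewrite coef1_poly_of_coef_vector /=; apply/matrixP => i j.
  by rewrite !ord1 !mxE eqxx mulr1n.
- by apply/rowP => j; rewrite mxE coefSS_poly_of_coef_vector.
- by apply/rowP => j; rewrite mxE coefSS_poly_of_coef_vector.
Qed.

(** Coordinates forget the constant term, the imaginary part of the linear coefficient and all
    degrees beyond [n.-1.+1]; the hypotheses control these. *)
Lemma coef_vector_real_lead_inj n (p q : {poly C}) :
  p`_0 = q`_0 -> (p`_1)^* = p`_1 -> (q`_1)^* = q`_1 ->
  (size p <= n.-1.+2)%N -> (size q <= n.-1.+2)%N ->
  coef_vector n p = coef_vector n q -> p = q.
Proof.
move=> pq0 p1 q1 sp sq /eq_row_mx[/matrixP /(_ 0 0)]; rewrite !mxE eqxx !mulr1n => re1.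
move=> /eq_row_mx[/rowP re /rowP im]; apply/polyP => -[|[|j]] //.
  have im0 (z : C) : z^* = z -> complex.Im z = 0.
    by case: z => x y /= [] /eqP; rewrite eq_sym -addr_eq0 -mulr2n mulrn_eq0 => /eqP.
  by move: re1 (im0 _ p1) (im0 _ q1); case: (p`_1) => ? ?; case: (q`_1) => ? ? /= -> -> ->.
have [jn|nj] := ltnP j n.-1; last by rewrite !nth_default// ?(leq_trans sp) ?(leq_trans sq).
have := re (Ordinal jn); have := im (Ordinal jn); rewrite !mxE /=.
by case: (p`_j.+2) => ? ?; case: (q`_j.+2) => ? ? /= -> ->.
Qed.

(** Serves tangent directions, whose linear coefficient may be zero or negative and whose degree may
    drop. *)
Lemma poly_of_coef_vector_real n (p : {poly C}) :
  p`_0 = 0 -> (p`_1)^* = p`_1 -> (size p <= n.-1.+2)%N ->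
  poly_of_coef_vector (coef_vector n p) = p.
Proof.
move=> p0 p1 sp; apply: (@coef_vector_real_lead_inj n) => //.
- by rewrite coef0_poly_of_coef_vector.
- by rewrite coef1_poly_of_coef_vector conjc_real.
- exact: size_poly_of_coef_vector.
- by rewrite poly_of_coef_vectorK.
Qed.

End CoefVector.

(** * Real differentiability of complex-valued and polynomial-valued maps *)

Section ComplexDifferential.
Variables (R : realType) (V : normedModType R) (a : V).
Local Notation C := R[i].
Local Notation "x ^*" := (conjc x) : ring_scope.
Implicit Types (f g df dg : V -> C) (p q dp dq : V -> {poly C}).

(** Real differentiability, by components, so that conjugation is allowed. *)
Definition cdiff f df :=
  is_diff a (fun x => complex.Re (f x) : R) (fun v => complex.Re (df v) : R) /\
  is_diff a (fun x => complex.Im (f x) : R) (fun v => complex.Im (df v) : R).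

Lemma cdiff_eq f df dg : cdiff f df -> (forall v, df v = dg v) -> cdiff f dg.
Proof. by move=> + /funext <-. Qed.

Lemma cdiff_cst c : cdiff (fun=> c) (fun=> 0).
Proof. by split; exact: is_diff_cst. Qed.

Lemma cdiffD f df g dg : cdiff f df -> cdiff g dg ->
  cdiff (fun x => f x + g x) (fun v => df v + dg v).
Proof.
move=> [f1 f2] [g1 g2]; split.
  under eq_fun do rewrite Re_addc; under [X in is_diff _ _ X]eq_fun do rewrite Re_addc.
  exact: is_diffD.
under eq_fun do rewrite Im_addc; under [X in is_diff _ _ X]eq_fun do rewrite Im_addc.
exact: is_diffD.
Qed.

Lemma cdiffM f df g dg : cdiff f df -> cdiff g dg ->
  cdiff (fun x => f x * g x) (fun v => df v * g a + f a * dg v).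
Proof.
move=> [f1 f2] [g1 g2]; split.
  under eq_fun do rewrite Re_mulc.
  apply: is_diff_eq (is_diffB (is_diffM f1 g1) (is_diffM f2 g2)) _.
  by apply/funext => v; rewrite !fctE Re_addc !Re_mulc /GRing.scale /=; ring.
under eq_fun do rewrite Im_mulc.
apply: is_diff_eq (is_diffD (is_diffM f1 g2) (is_diffM f2 g1)) _.
by apply/funext => v; rewrite !fctE Im_addc !Im_mulc /GRing.scale /=; ring.
Qed.

Lemma cdiff_conjc f df : cdiff f df -> cdiff (fun x => (f x)^*) (fun v => (df v)^*).
Proof.
move=> [f1 f2]; have conjE (z : C) : z^* = Complex (complex.Re z) (- complex.Im z).
  by case: z.
split; first by under eq_fun do rewrite conjE /=; under [X in is_diff _ _ X]eq_fun do rewrite conjE.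
under eq_fun do rewrite conjE /=; under [X in is_diff _ _ X]eq_fun do rewrite conjE /=.
exact: is_diffN.
Qed.

Lemma cdiff_sum (I : Type) (r : seq I) (f df : I -> V -> C) :
  (forall i, cdiff (f i) (df i)) ->
  cdiff (fun x => \sum_(i <- r) f i x) (fun v => \sum_(i <- r) df i v).
Proof.
move=> fd; elim: r => [|i r ih].
  under eq_fun do rewrite big_nil; apply: cdiff_eq (cdiff_cst 0) _ => v.
  by rewrite big_nil.
under eq_fun do rewrite big_cons; apply: cdiff_eq (cdiffD (fd i) ih) _ => v.
by rewrite big_cons.
Qed.

Lemma cdiffZ c f df : cdiff f df -> cdiff (fun x => c * f x) (fun v => c * df v).
Proof.
by move=> fd; apply: cdiff_eq (cdiffM (cdiff_cst c) fd) _ => v; rewrite mul0r add0r.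
Qed.

Definition pdiff p dp := forall j, cdiff (fun x => (p x)`_j) (fun v => (dp v)`_j).

Lemma pdiff_eq p dp dq : pdiff p dp -> (forall v, dp v = dq v) -> pdiff p dq.
Proof. by move=> + /funext <-. Qed.

Lemma pdiff_cst (c : {poly C}) : pdiff (fun=> c) (fun=> 0).
Proof. by move=> j; apply: cdiff_eq (cdiff_cst _) _ => v; rewrite coef0. Qed.

Lemma pdiffM p dp q dq : pdiff p dp -> pdiff q dq ->
  pdiff (fun x => p x * q x) (fun v => dp v * q a + p a * dq v).
Proof.
move=> pd qd j; under eq_fun do rewrite coefM.
have := cdiff_sum (index_enum 'I_j.+1) (fun i => cdiffM (pd i) (qd (j - i)%N)).
move/cdiff_eq; apply => v.
by rewrite coefD !coefM big_split.
Qed.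

Lemma pdiffX p dp k : pdiff p dp ->
  pdiff (fun x => p x ^+ k) (fun v => k%:R * p a ^+ k.-1 * dp v).
Proof.
move=> pd; elim: k => [|k ih].
  by apply: pdiff_eq (pdiff_cst 1) _ => v; rewrite !mul0r.
under eq_fun do rewrite exprS; apply: pdiff_eq (pdiffM pd ih) _ => v.
case: k {ih} => [|k]; first by rewrite !mul0r mulr0 expr0; ring.
by rewrite -[in RHS]natr1 [_.-1]/= [_.-1]/= !exprS; ring.
Qed.

Lemma pdiff_deriv p dp : pdiff p dp -> pdiff (fun x => (p x)^`()) (fun v => (dp v)^`()).
Proof.
move=> pd j.
under eq_fun do rewrite coef_deriv -mulr_natl.
by apply: (cdiff_eq (cdiffZ j.+1%:R (pd j.+1))) => v; rewrite coef_deriv mulr_natl.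
Qed.

Lemma cdiff_bergman_prod N p dp q dq : pdiff p dp -> pdiff q dq ->
  cdiff (fun x => bergman_prod N (p x) (q x))
        (fun v => bergman_prod N (dp v) (q a) + bergman_prod N (p a) (dq v)).
Proof.
move=> pd qd; rewrite /bergman_prod; under eq_fun do under eq_bigr do rewrite mulrC.
have := cdiff_sum (index_enum 'I_N) (fun i =>
  cdiffZ (i.+1%:R^-1) (cdiffM (pd i) (cdiff_conjc (qd i)))).
move/cdiff_eq; apply => v.
by rewrite -big_split; apply: eq_bigr => j _; rewrite /= mulrDr ![_^-1 * _]mulrC.
Qed.

Lemma is_diff_ext (W : normedModType R) (f g df dg : V -> W) :
  f =1 g -> df =1 dg -> is_diff a f df -> is_diff a g dg.
Proof. by move=> /funext -> /funext ->. Qed.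

Lemma is_diff_row m (f df : V -> 'rV[R]_m) :
  (forall j, is_diff a (fun x => f x 0 j) (fun v => df v 0 j)) -> is_diff a f df.
Proof.
move=> fd.
have fE : f = fun x => \sum_j f x 0 j *: delta_mx 0 j.
  by apply/funext => x; exact: row_sum_delta.
have term j : is_diff a (fun x => f x 0 j *: (delta_mx 0 j : 'rV[R]_m))
    (fun v => df v 0 j *: delta_mx 0 j).
  have fj := fd j; apply: DiffDef; first exact: differentiableZl.
  by rewrite diffZl//; apply/funext => v; rewrite diff_val.
rewrite fE; have -> : df = fun v => \sum_j df v 0 j *: delta_mx 0 j.
  by apply/funext => x; exact: row_sum_delta.
elim: (index_enum _) => [|j r ih].
  by apply: is_diff_ext (is_diff_cst (0 : 'rV[R]_m) a) => x; rewrite big_nil.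
by apply: is_diff_ext (is_diffD (term j) ih) => x; rewrite big_cons.
Qed.

Lemma is_diff_real_coords n (u du : nat -> V -> C) :
  (forall k, cdiff (u k) (du k)) ->
  is_diff a (fun x => real_coords n (fun k => u k x))
            (fun v => real_coords n (fun k => du k v)).
Proof.
move=> ud; apply: is_diff_row => j.
case: (split_ordP j) => [i ->|i ->].
  by have [h _] := ud 0%N; apply: is_diff_ext h => x;
    rewrite row_mxEl mxE ord1 eqxx mulr1n.
case: (split_ordP i) => [k ->|k ->].
  by have [h _] := ud k.+1; apply: is_diff_ext h => x; rewrite row_mxEr row_mxEl mxE.
by have [_ h] := ud k.+1; apply: is_diff_ext h => x; rewrite row_mxEr row_mxEr mxE.
Qed.

End ComplexDifferential.

(** * The kernel of the differential of the moment map *)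

Section MomentDifferential.
Variable R : realType.
Local Notation C := R[i].
Local Notation "x ^*" := (conjc x) : ring_scope.

Lemma cdiff_coord N (a : 'rV[R]_N) (j : 'I_N) :
  cdiff a (fun x : 'rV[R]_N => real_complex R (x 0 j)) (fun v => real_complex R (v 0 j)).
Proof.
split; last exact: (is_diff_cst (0 : R)).
have @f : {linear 'rV[R]_N -> R}.
  by exists (fun x : 'rV[R]_N => x 0 j); do 2![eexists]; do ?[constructor];
     rewrite ?mxE// => ? *; rewrite ?mxE//; move=> ?; rewrite !mxE.
have fc : continuous f by exact: coord_continuous.
by apply: DiffDef; [exact: differentiable_coord|exact: (diff_lin a fc)].
Qed.

(** The map is real linear, hence its own differential. *)
Lemma pdiff_poly_of_coef_vector n (a : 'rV[R]_(1 + (n.-1 + n.-1))) :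
  pdiff a (@poly_of_coef_vector R n) (@poly_of_coef_vector R n).
Proof.
move=> i.
have E (x : 'rV[R]_(1 + (n.-1 + n.-1))) : (poly_of_coef_vector x)`_i =
    ('X : {poly C})`_i * real_complex R (x 0 (lshift _ 0)) + \sum_(j < n.-1)
      ('X^(j.+2) : {poly C})`_i * (real_complex R (x 0 (rshift 1 (lshift n.-1 j))) +
      'i%C * real_complex R (x 0 (rshift 1 (rshift n.-1 j)))).
  rewrite coefD coefZ mulrC !mxE coef_sum; congr (_ + _); apply: eq_bigr => j _.
  by rewrite coefZ mulrC !mxE [Complex _ _]complexE.
rewrite (funext E); apply: cdiffD; first exact/cdiffZ/cdiff_coord.
apply: cdiff_sum => j; apply: cdiffZ; apply: cdiffD; first exact: cdiff_coord.
exact/cdiffZ/cdiff_coord.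
Qed.

(** Derivation cancels the Bergman weights [1 / (j + 1)]; what remains is the Hermitian product of
    the coefficients, which reversal turns into a single coefficient. *)
Lemma bergman_prod_deriv m (f g : {poly C}) :
  bergman_prod m.+1 (f * 'X)^`() g = (f * conj_rev m g)`_m.
Proof.
rewrite coef_mul_conj_rev; apply: eq_bigr => j _.
by rewrite coef_deriv coefMX /= mulrnAl -[X in X / _]mulr_natr mulfK// pnatr_eq0.
Qed.

Lemma bergman_prod_conj N (f g : {poly C}) :
  bergman_prod N f g = (bergman_prod N g f)^*.
Proof.
rewrite /bergman_prod rmorph_sum; apply: eq_bigr => j _.
by rewrite !rmorphM /= conjcK conjc_inv conjc_nat [in RHS](mulrC (g`_j)^*).
Qed.

Lemma bergman_prod_derivr m (f g : {poly C}) :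
  bergman_prod m.+1 f (g * 'X)^`() = (f * conj_rev m g)`_m.
Proof.
rewrite bergman_prod_conj bergman_prod_deriv !coef_mul_conj_rev rmorph_sum.
by apply: eq_bigr => j _; rewrite rmorphM /= conjcK mulrC.
Qed.

Definition area_constant : R :=
  pi^-1 * fine ((@lebesgue_measure R \x @lebesgue_measure R)%E (@unit_disk R)).

Lemma diff_moment_map m (a v : 'rV[R]_(1 + (m + m))) (g : {poly C}) :
  let q := (@poly_of_coef_vector R m.+1 a)^`() in
  @poly_of_coef_vector R m.+1 v = g * 'X ->
  'd (@moment_map R m.+1) a v = real_coords m.+1 (fun k =>
    real_complex R area_constant * (@poly_of_coef_vector R m.+1 a ^+ k *
      (g * conj_rev m q + q * conj_rev m g))`_m).
Proof.
move=> q vE.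
pose pa := @poly_of_coef_vector R m.+1.
have pd : pdiff a pa pa by exact: (@pdiff_poly_of_coef_vector m.+1).
have sd x : (size (pa x)^`() <= m.+1)%N.
  by apply: leq_trans (size_poly _ _) _; have := size_poly_of_coef_vector x; case: size.
have md : @moment_map R m.+1 = fun x => real_coords m.+1 (fun k =>
    real_complex R area_constant * bergman_prod m.+1 (pa x ^+ k * (pa x)^`()) (pa x)^`()).
  apply/funext => x; rewrite /moment_map; congr real_coords; apply/funext => k.
  by rewrite (moment_bergman _ (sd x)).
have dm k := cdiffZ (real_complex R area_constant)
  (cdiff_bergman_prod m.+1 (pdiffM (pdiffX k pd) (pdiff_deriv pd)) (pdiff_deriv pd)).
have D := is_diff_real_coords m.+1 dm.
rewrite md (diff_val (is_diff_def := D)); congr real_coords; apply/funext => k; congr (_ * _).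
rewrite -/pa in q vE *; rewrite vE -/q.
(* The variations of [P ^+ k] and of the left factor [P'] add up to one derivative, so
   [bergman_prod_deriv] applies. *)
have -> : k%:R * pa a ^+ k.-1 * (g * 'X) * q + pa a ^+ k * (g * 'X)^`() =
    (pa a ^+ k * g * 'X)^`().
  by rewrite -[pa a ^+ k * g * 'X]mulrA [RHS]derivM deriv_exp -[_ *+ k]mulr_natl -/q; ring.
by rewrite bergman_prod_deriv bergman_prod_derivr -coefD -!mulrA -mulrDr.
Qed.

Lemma real_coords_eq0 n (u : nat -> C) : real_coords n u = 0 <->
  complex.Re (u 0) = 0 /\ forall j, (j < n.-1)%N -> u j.+1 = 0.
Proof.
split=> [|[u0 uS]].
  rewrite -[RHS]row_mx0 => /eq_row_mx[/matrixP/(_ 0 0)]; rewrite !mxE eqxx mulr1n => u0.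
  rewrite -row_mx0 => /eq_row_mx[/rowP re /rowP im]; split=> // j jn.
  have := re (Ordinal jn); have := im (Ordinal jn); rewrite !mxE /=.
  by case: (u j.+1) => x y /= -> ->.
rewrite /real_coords u0 raddf0 -[RHS]row_mx0; congr row_mx; rewrite -[RHS]row_mx0.
by congr row_mx; apply/rowP => j; rewrite !mxE uS.
Qed.

Lemma coef_vector_eq0 n (p : {poly C}) : p = 0 -> coef_vector n p = 0.
Proof. by move=> ->; apply/real_coords_eq0; rewrite coef0; split=> // j _; rewrite coef0. Qed.

(** Tangent vectors are the polynomials X g of degree at most [m.+1] with g(0) real. *)
Lemma degenerate_atP m (P : {poly C}) : normalized_poly m.+1 P ->
  let q := P^`() in
  degenerate_at m.+1 P <-> exists g : {poly C},
    [/\ g != 0, (size g <= m.+1)%N, (g`_0)^* = g`_0 &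
        g * conj_rev m q + q * conj_rev m g = 0].
Proof.
move=> nP q; have [sP P0 P1] := nP.
have PK : poly_of_coef_vector (coef_vector m.+1 P) = P by exact: coef_vectorK.
have sq : (size q <= m.+1)%N by apply: leq_trans (size_poly _ _) _; rewrite sP.
have c0 : real_complex R area_constant != 0 by rewrite fmorph_eq0 pi_area_neq0.
rewrite /degenerate_at bijective_linear_rowP; split.
  move=> /existsNP[v /not_implyP[dv /eqP v0]].
  have [g gE] : exists g, @poly_of_coef_vector R m.+1 v = g * 'X.
    have /factor_theorem[g ->] : root (@poly_of_coef_vector R m.+1 v) 0.
      by rewrite rootE horner_coef0 coef0_poly_of_coef_vector.
    by exists g; rewrite subr0.
  have g0 : g != 0.
    apply: contra_neq v0 => g0.
    by rewrite -[LHS](@poly_of_coef_vectorK R m.+1) coef_vector_eq0// gE g0 mul0r.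
  have sg : (size g <= m.+1)%N.
    by have := size_poly_of_coef_vector (n := m.+1) v; rewrite gE size_mulX.
  exists g; split=> //.
    have := coef1_poly_of_coef_vector (n := m.+1) v.
    by rewrite gE coefMX /= => ->; rewrite conjc_real.
  move: dv; rewrite (@diff_moment_map m _ v g gE) PK -/q; set w := g * _ + _.
  have wE : conj_rev (m + m) w = w by exact: conj_rev_herm.
  move=> /real_coords_eq0[w0 wS].
  apply: (herm_lower_eq0 wE); apply: (coef_powers_mul_eq0 P0 (lt0r_neq0 P1)) => -[_|k km].
    (* For k = 0 the coordinates only control the real part of the middle coefficient of [w];
       self-reciprocity makes that coefficient real. *)
    move: w0; rewrite expr0 mul1r.
    have : w`_m = (w`_m)^* by rewrite -{1}wE coef_poly ltnS leq_addl addKn.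
    case: (w`_m) => x y /= [] /eqP; rewrite -addr_eq0 -mulr2n mulrn_eq0 /= => /eqP -> /eqP.
    rewrite mulr0 subr0 mulf_eq0; move: c0; rewrite fmorph_eq0 => /negPf -> /= /eqP -> //.
  by have /eqP := wS _ km; rewrite mulf_eq0 (negPf c0) => /eqP.
move=> [g [g0 sg g0r gq]].
have gXK : @poly_of_coef_vector R m.+1 (coef_vector m.+1 (g * 'X)) = g * 'X.
  apply: poly_of_coef_vector_real; rewrite ?coefMX//.
  by rewrite size_mulX.
move=> /(_ (coef_vector m.+1 (g * 'X))); rewrite (@diff_moment_map m _ _ g gXK) PK -/q gq.
have -> : real_coords m.+1 (fun k => real_complex R area_constant * (P ^+ k * 0)`_m) = 0.
  by apply/real_coords_eq0; split=> [|j _]; rewrite mulr0 coef0 mulr0.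
move=> /(_ erefl) v0; move: gXK.
rewrite v0 -(coef_vector_eq0 m.+1 erefl) poly_of_coef_vector_real ?coef0 ?conjc0 ?size_poly0//.
by move/esym/eqP; rewrite mulf_eq0 polyX_eq0 orbF (negPf g0).
Qed.

End MomentDifferential.

(** * Degeneracy read off from the roots of P' *)

Theorem corollary1 (R : realType) (n : nat) (hn : (1 <= n)%N)
    (P : {poly R[i]}) (hP : normalized_poly n P)
    (alpha : 'I_n.-1 -> R[i])
    (halpha : P^`() = lead_coef P^`() *: \prod_(i < n.-1) ('X - (alpha i)%:P)) :
  degenerate_at n P <->
  exists i j : 'I_n.-1, alpha i * conjc (alpha j) = 1.
Proof.
case: n hn hP alpha halpha => // m _ hP alpha qE; set q := P^`() in qE.
have [sP P0 P1] := hP.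
have q0 : 0 < q`_0 by rewrite coef_deriv mulr1n.
have qN0 : q != 0 by apply: contraTneq q0 => ->; rewrite coef0 ltxx.
have sq : size q = m.+1.
  by rewrite qE size_scale ?lead_coef_eq0// size_prod_XsubC -[index_enum _]enumT -cardE card_ord.
have rootq z : reflect (exists i, z = alpha i) (root q z).
  rewrite qE rootZ ?lead_coef_eq0// -(big_map alpha xpredT (fun a => 'X - a%:P)).
  rewrite root_prod_XsubC; apply: (iffP mapP) => [[i _ ->]|[i ->]]; exists i => //.
  exact: mem_index_enum.
rewrite (degenerate_atP hP); split.
  move=> [g [g0 sg g0r gq]].
  (* A nonzero solution [g] excludes coprimality, and a common root of q and q# yields the two
     roots. *)
  have [cop|/(exists_inverse_conj_roots sq (lt0r_neq0 q0))] := boolP (coprimep q (conj_rev m q)).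
    by rewrite (coprime_conj_rev_eq0 sq q0 cop sg g0r gq) eqxx in g0.
  by move=> [a [b [/rootq[i ->] /rootq[j ->] ij]]]; exists i, j.
move=> [i [j ij]]; apply: (exists_conj_rev_solution sq q0 _ _ ij).
  by apply/rootq; exists i.
by apply/rootq; exists j.
Qed.
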